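(* Let $\mathcal{H}^n=\{\mathbf{y}\in\mathbb{R}^{n+1} : c(\mathbf{y})=0\}$ be a hypersurface, where $c:\mathbb{R}^{n+1}\to\mathbb{R}$ is a $C^1$ function with $\nabla c(\mathbf{y})\neq \mathbf{0}$ for all $\mathbf{y}\in\mathcal{H}^n$. If $\mathcal{H}^n$ is the boundary $\partial\mathcal{K}$ of a convex set $\mathcal{K}\subset\mathbb{R}^{n+1}$, then the consensus seeking system on $\mathcal{H}^n$ given by $$\dot{\mathbf{x}}_i=\left(\mathbf{I}-\mathbf{n}_i\mathbf{n}_i^{\top}\right)\sum_{j\in\mathcal{N}_i}a_{ij}(\mathbf{x}_j-\mathbf{x}_i),\qquad i\in\mathcal{V},$$ satisfies $$\lim_{t\to\infty}\|\mathbf{x}_i(t)\|<\infty$$ for all initial conditions $(\mathbf{x}_i(0))_{i=1}^N\in(\mathcal{H}^n)^N$ and all $i\in\mathcal{V}$.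
   Context: $\mathcal{G}=(\mathcal{V},\mathcal{E})$ is an undirected graph with node set $\mathcal{V}=\{1,\dots,N\}$, whose nodes correspond to agents and whose edges $\{i,j\}\in\mathcal{E}$ correspond to pairs of communicating agents. $\mathcal{N}_i=\{j\in\mathcal{V} : \{i,j\}\in\mathcal{E}\}$ is the set of neighbors of $i$, and the weights satisfy $a_{ij}=a_{ji}\in[0,\infty)$. $\mathbf{x}_i(t)\in\mathcal{H}^n$ is the state of agent $i$ at time $t$. The vector $\mathbf{n}_i=\nabla c(\mathbf{x}_i)/\|\nabla c(\mathbf{x}_i)\|$ is the unit normal of $\mathcal{H}^n$ at $\mathbf{x}_i$ given by the Gauss map, so that $\mathbf{I}-\mathbf{n}_i\mathbf{n}_i^\top$ is the orthogonal projection of $\mathbb{R}^{n+1}$ onto the tangent space of $\mathcal{H}^n$ at $\mathbf{x}_i$. $\|\cdot\|$ is the Euclidean norm. The system is the gradient descent flow on $(\mathcal{H}^n)^N$ of the disagreement function $V(\mathbf{x})=\tfrac12\sum_{\{i,j\}\in\mathcal{E}}a_{ij}\|\mathbf{x}_j-\mathbf{x}_i\|^2$, where $\mathbf{x}=(\mathbf{x}_i)_{i=1}^N$.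
   Formalization: The limit of ‖x_i(t)‖ is replaced by the limit superior (each trajectory stays bounded), since the limit itself need not exist: on some smooth convex surfaces a trajectory accumulates on a whole circle along which the norm varies. *)

(* Defs.v *)
From HB Require Import structures.
From mathcomp Require Import all_boot all_order all_algebra.
From mathcomp Require Import all_classical all_reals all_analysis.

Set Implicit Arguments.
Unset Strict Implicit.
Unset Printing Implicit Defensive.

Import Order.TTheory GRing.Theory Num.Theory.
Import numFieldNormedType.Exports.

Local Open Scope classical_set_scope.
Local Open Scope ring_scope.

Section Hypersurface.
Context {R : realType} {n : nat}.
Implicit Types (v y : 'cV[R]_n.+1) (c : 'cV[R]_n.+1 -> R).

(* The library norm `|v| on column vectors is the sup norm; it induces the
   usual topology, but the metric statements below need the Euclidean one. *)
Definition enorm v : R := Num.sqrt (\sum_k v k 0 ^+ 2).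

Definition grad c y : 'cV[R]_n.+1 := \col_k 'D_(delta_mx k 0) c y.

Definition C1 c : Prop := (forall y, differentiable c y) /\ continuous (grad c).

Definition level_set c : set 'cV[R]_n.+1 := [set y | c y = 0].

Definition regular c : Prop := forall y, level_set c y -> grad c y != 0.

Definition unit_normal c y : 'cV[R]_n.+1 := (enorm (grad c y))^-1 *: grad c y.

Definition tangent_proj c y : 'M[R]_n.+1 :=
  1%:M - unit_normal c y *m (unit_normal c y)^T.

Definition boundary (K : set 'cV[R]_n.+1) : set 'cV[R]_n.+1 :=
  closure K `\` interior K.

End Hypersurface.

Section Consensus.
Context {R : realType} {n N : nat}.

Definition consensus_field (c : 'cV[R]_n.+1 -> R) (e : rel 'I_N)
    (a : 'I_N -> 'I_N -> R) (x : 'I_N -> 'cV[R]_n.+1) (i : 'I_N) :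
    'cV[R]_n.+1 :=
  tangent_proj c (x i) *m \sum_(j < N | e i j) a i j *: (x j - x i).

(* A forward solution on [0, +oo[ with x(0) = x0 in the state space
   (level_set c)^N.  Only the values x t with 0 <= t are constrained, so the
   derivative is required for 0 < t and only (one-sided) continuity at t = 0;
   when the vector field is continuous on the state space this is the same as
   also requiring the right derivative at t = 0. *)
Definition consensus_solution (c : 'cV[R]_n.+1 -> R) (e : rel 'I_N)
    (a : 'I_N -> 'I_N -> R) (x0 : 'I_N -> 'cV[R]_n.+1)
    (x : R -> 'I_N -> 'cV[R]_n.+1) : Prop :=
  [/\ forall i, x 0 i = x0 i,
      forall (t : R) i, 0 <= t -> level_set c (x t i),
      forall i, {within `[0, +oo[, continuous (fun t : R => x t i)} &
      forall (t : R) i, 0 < t ->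
        is_derive t 1 (fun s : R => x s i) (consensus_field c e a (x t) i)].

End Consensus.

(* Main.v *)
(* At every y in H the linear form <n(y), . - y> has a constant sign on the
   closure C of K, and C is unbounded only along its recession cone.  If d is a
   recession direction, then <n_i, d> and all the <n_i, x_j - x_i> have the same
   sign, and the a_ij-forces cancel in pairs, so sum_i <x_i, d> is
   nonincreasing.  If both d and -d are recession directions, then <n_i, d> = 0,
   the projection disappears, the coordinates <x_i, d> follow a linear consensus
   dynamics and sum_i <x_i, d>^2 is nonincreasing.

   Suppose M = sum_i |x_i| is unbounded on [0, +oo[.  Along an ultrafilter with
   M -> +oo, x_i / M converges to some r_i, which is a recession direction of C,
   and sum_i |r_i| = 1.  The first monotonicity with d = sum_i r_i gives
   |d|^2 <= 0, so sum_i r_i = 0.  Hence - r_i = sum_(j != i) r_j is a recession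
   direction too, and the second monotonicity with d = r_i gives r_i = 0 for
   every i, a contradiction. *)

Require Import Defs.
From HB Require Import structures.
From mathcomp Require Import all_boot all_order all_algebra.
From mathcomp Require Import all_classical all_reals all_analysis.
From mathcomp Require Import ring lra.

Import Order.TTheory GRing.Theory Num.Theory.
Import numFieldNormedType.Exports.

Set Implicit Arguments.
Unset Strict Implicit.
Unset Printing Implicit Defensive.

Local Open Scope classical_set_scope.
Local Open Scope ring_scope.

(** * Convex sets: closure, interior and boundary *)

Section ConvexSets.
Context {R : realType} {V : normedModType R}.
Implicit Types (K : set V) (x y z v : V) (s t : R).

Lemma convex_setP K : convex_set K <->
  forall x y s, 0 <= s <= 1 -> K x -> K y -> K (s *: x + (1 - s) *: y).
Proof.
split=> [cK x y s s01 Kx Ky|cK x y l].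
  have /= := cK x y (Itv01 (proj1 (andP s01)) (proj2 (andP s01))).
  by rewrite !inE; apply.
by rewrite !inE => Kx Ky; apply: cK => //; rewrite ge0 le1.
Qed.

Lemma convex_closure K : convex_set K -> convex_set (closure K).
Proof.
move=> /convex_setP cK; apply/convex_setP => x y s /andP[s0 s1] Kx Ky B.
move=> /nbhs_normP[e /= e0 eB].
have ball_nbhs z : nbhs z (ball z e) by exact: nbhsx_ballx.
have [x' [Kx' ]] := Kx _ (ball_nbhs x); rewrite -ball_normE /= => xx'.
have [y' [Ky' ]] := Ky _ (ball_nbhs y); rewrite -ball_normE /= => yy'.
exists (s *: x' + (1 - s) *: y'); split; first by apply: cK; rewrite ?s0.
apply: eB => /=.
rewrite opprD addrACA -!scalerBr (le_lt_trans (ler_normD _ _))//.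
rewrite !normrZ (ger0_norm s0) ger0_norm ?subr_ge0//.
have [->|sN0] := eqVneq s 0; first by rewrite mul0r add0r subr0 mul1r.
have sp : 0 < s by rewrite lt_neqAle eq_sym sN0.
have -> : e = s * e + (1 - s) * e by ring.
by rewrite ltr_leD ?ltr_pM2l// ler_wpM2l ?subr_ge0// ltW.
Qed.

(** Every [w] near [y] is the midpoint of [y - v] and of [2w - (y - v)]; the latter is near [y + v],
    hence in [K]. *)
Lemma convex_midpoint_interior K y v : convex_set K ->
  K^° (y + v) -> K^° (y - v) -> K^° y.
Proof.
move=> /convex_setP cK /nbhs_normP[e /= e0 eK] /interior_subset Kyv.
apply/nbhs_normP; exists (e / 2) => /=; first by rewrite divr_gt0.
move=> w /= yw.
have -> : w = 2^-1 *: (w + (w - (y - v))) + (1 - 2^-1) *: (y - v).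
  have -> : 1 - 2^-1 = 2^-1 :> R by field.
  rewrite -scalerDr -addrA subrK -mulr2n -[X in _ *: X]scaler_nat scalerA.
  by rewrite mulVf// scale1r.
apply: cK => //; first by lra.
apply: eK => /=.
have -> : y + v - (w + (w - (y - v))) = 2 *: (y - w).
  rewrite scaler_nat mulr2n !opprD !opprK addrACA [v + _]addrC !addrA subrK.
  by rewrite -[in LHS]addrA -[in RHS]addrA [- w + _]addrC.
by rewrite normrZ ger0_norm// mulrC -ltr_pdivlMr.
Qed.

(** A segment avoiding the boundary meets [K^°] and [closure K] in the same set, which is therefore
    relatively open and closed in a connected set, and contains [x]. *)
Lemma segment_interior K x y : K^° x ->
  (forall s, 0 <= s <= 1 -> ~ (closure K `\` K^°) (x + s *: (y - x))) ->
  K^° y.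
Proof.
move=> Kx bK.
pose f s := x + s *: (y - x).
have cf : continuous f.
  move=> s; apply: cvgD; first exact: cvg_cst.
  by apply: cvgZr_tmp; exact: cvg_id.
have cD : connected (f @` `[0, 1]).
  apply: connected_continuous_connected; first exact: segment_connected.
  exact: continuous_subspaceT.
have : f @` `[0, 1] `<=` K^°; last first.
  by apply; exists 1; rewrite /f ?scale1r ?subrKC//= in_itv/= ler01 lexx.
have f0 : (f @` `[0, 1]) x.
  by exists 0; rewrite /f ?scale0r ?addr0//= in_itv/= ler01 lexx.
apply/setIidPl; apply: cD.
- by exists x.
- by exists K^° => //; exact: open_interior.
- exists (closure K); first exact: closed_closure.
  rewrite predeqE => z; split=> -[fz Kz]; split => //.
    by apply: subset_closure; exact: interior_subset.
  move: fz => [s s01 fs]; apply: contrapT => Nz.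
  by apply: (bK s) => //; rewrite -/(f s) fs.
Qed.

End ConvexSets.

(** * One-sidedness of the differential at a boundary point *)

Section SupportingHyperplane.
Context {R : realType} {V : normedModType R}.
Implicit Types (K : set V) (f : V -> R) (y z v w : V).

(** By linearity the differential is at least [m > 0] on the whole segment from [v] to [w], and the
    segment is bounded, so one small [s] makes the first-order remainder harmless for all [t] at
    once. *)
Lemma differentiable_pos_segment f y v w : differentiable f y -> f y = 0 ->
  0 < 'd f y v -> 0 < 'd f y w ->
  \forall s \near 0^'+, forall t, 0 <= t <= 1 ->
    0 < f (y + s *: (v + t *: (w - v))).
Proof.
move=> df fy dv dw.
pose m : R := Num.min ('d f y v) ('d f y w).
pose B := `|v| + `|w - v| + 1.
have m0 : 0 < m by rewrite lt_min dv.
have B0 : 0 < B by rewrite ltr_pwDr.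
have B1 : 0 < B + 1 by exact: addr_gt0.
have := diff_locallyx df.
set o := (X in forall h, _ = _ + X h) => fE.
have oP (e : R) : 0 < e -> \forall h \near (0 : V), `|o h| <= e * `|h|.
  exact: littleoP.
(* Since [|u| <= B < B + 1] on the segment, this rate keeps the remainder at [s *: u] strictly below
   [s * m]. *)
have /nbhs_normP[d /= d0 dP] := oP _ (divr_gt0 m0 B1).
near=> s => t /andP[t0 t1].
have s0 : 0 < s by near: s; exact: nbhs_right_gt.
set u := v + _.
have uB : `|u| <= B.
  rewrite (le_trans (ler_normD _ _))// normrZ ger0_norm// /B -addrA lerD2l.
  by rewrite (le_trans (ler_piMl _ t1))// lerDl.
have du : m <= 'd f y u.
  have -> : 'd f y u = (1 - t) * 'd f y v + t * 'd f y w.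
    by rewrite /u linearD linearZ linearB /= /GRing.scale/=; ring.
  have -> : m = (1 - t) * m + t * m by ring.
  by rewrite lerD// ler_wpM2l ?subr_ge0// ge_min lexx ?orbT.
have os : `|o (s *: u)| <= m / (B + 1) * `|s *: u|.
  apply: dP => /=; rewrite sub0r normrN normrZ gtr0_norm//.
  rewrite (@le_lt_trans _ _ (s * B)) ?ler_wpM2l ?(ltW s0)//.
  rewrite -ltr_pdivlMr//; near: s; apply: nbhs_right_lt.
  by rewrite divr_gt0.
rewrite addrC fE fy add0r linearZ /= /GRing.scale/=.
rewrite -ltrBlDr sub0r (@le_lt_trans _ _ `|o (s *: u)|)//.
  by rewrite -normrN ler_norm.
rewrite (le_lt_trans os)// normrZ gtr0_norm//.
rewrite mulrCA ltr_pM2l// (lt_le_trans _ du)//.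
rewrite mulrAC ltr_pdivrMr// ltr_pM2l//.
by rewrite (le_lt_trans uB)// ltrDl.
Unshelve. all: by end_near. Qed.

(* If the differential took both signs on K - y, the points of K on the side
   f > 0 would connect, without meeting the boundary, to the reflection of a
   point on the side f < 0, so that y would be the midpoint of two interior
   points. *)
Lemma boundary_one_sided K f y z w : convex_set K ->
  (forall x, f x = 0 <-> (closure K `\` K^°) x) ->
  differentiable f y -> f y = 0 -> closure K z -> closure K w ->
  0 < 'd f y (z - y) -> 0 <= 'd f y (w - y).
Proof.
move=> cK fK df fy Kz Kw dz; rewrite leNgt; apply/negP => dw.
have /fK[Ky Ny] := fy.
have dNw : 0 < 'd f y (- (w - y)) by rewrite linearN oppr_gt0.
have dNf v : 'd (- f) y v = - 'd f y v by rewrite (diffN df).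
have near_pos := differentiable_pos_segment df fy dz dNw.
(* The degenerate segment from [w - y] to itself, applied to [- f], gives the sign of [f] at a
   single point. *)
have near_neg : \forall s \near 0^'+, forall t, 0 <= t <= 1 ->
    0 < (- f) (y + s *: ((w - y) + t *: ((w - y) - (w - y)))).
  apply: differentiable_pos_segment; rewrite ?dNf ?oppr_gt0//.
    exact: differentiableN.
  by rewrite opprfctE fy oppr0.
near (0 : R)^'+ => s.
have s0 : 0 < s by [].
have s1 : s <= 1 by near: s; exact: nbhs_right_le.
have pos t : 0 <= t <= 1 ->
  0 < f (y + s *: ((z - y) + t *: (- (w - y) - (z - y)))).
  by move: t; near: s.
have Nf_pos t : 0 <= t <= 1 ->
  0 < (- f) (y + s *: ((w - y) + t *: ((w - y) - (w - y)))).
  by move: t; near: s.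
have neg : f (y + s *: (w - y)) < 0.
  rewrite -oppr_gt0; have := Nf_pos 0.
  by rewrite lexx ler01 scale0r addr0; exact.
(* The point stays in the convex set [closure K]; where [f] does not vanish it is off the boundary,
   hence interior. *)
have int x : closure K x -> f (y + s *: (x - y)) != 0 ->
    K^° (y + s *: (x - y)).
  move=> Kx fx; apply: contrapT => Nx.
  move/eqP: fx; apply; apply/fK; split => //.
  have -> : y + s *: (x - y) = s *: x + (1 - s) *: y.
    by rewrite scalerBr scalerBl scale1r addrCA.
  have /convex_setP := convex_closure cK.
  by apply; rewrite ?(ltW s0).
(* The two interior points are [y - s *: (w - y)], joined to [y + s *: (z - y)] by a segment where
   [f > 0], and [y + s *: (w - y)], where [f < 0]. *)
apply: Ny; apply: (@convex_midpoint_interior _ _ _ _ (- (s *: (w - y)))) => //.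
  apply: (@segment_interior _ _ _ (y + s *: (z - y))) => [|t t01].
    apply: int => //; rewrite gt_eqF//.
    by have := pos 0; rewrite lexx ler01 scale0r addr0; exact.
  move/fK; apply/eqP; rewrite gt_eqF//.
  have := pos t t01; congr (0 < f _).
  rewrite scalerDr addrA; congr (_ + _).
  rewrite scalerA mulrC -scalerA; congr (_ *: _).
  by rewrite scalerBr scalerN opprD addrA [y + _ - y]addrAC subrr add0r.
by rewrite opprK; apply: int => //; rewrite lt_eqF.
Unshelve. all: by end_near. Qed.

End SupportingHyperplane.

(** * Entrywise limits of matrices and limits along ultrafilters *)

Lemma mx_entry_norm {R : realType} {m n : nat} (v : 'M[R]_(m, n)) i j :
  `|v i j| <= `|v|.
Proof.
rewrite [leRHS]/Num.Def.normr /= mx_normrE.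
exact: (le_bigmax _ (fun ij => `|v ij.1 ij.2|) (i, j)).
Qed.

Lemma cvg_mx {R : realType} {m n : nat} (T : Type) (F : set_system T)
    (f : T -> 'M[R]_(m, n)) (l : 'M[R]_(m, n)) : Filter F ->
  (forall i j, (fun t => f t i j) @ F --> l i j) -> f @ F --> l.
Proof.
move=> FF fl; apply/cvg_ballP => e e0.
suff : \forall t \near F, forall ij, ball (l ij.1 ij.2) e (f t ij.1 ij.2).
  by apply: filterS => t lt; split => // i j; exact: (lt (i, j)).
apply: filter_forall => -[i j] /=.
by move/cvg_ballP : (fl i j); apply.
Qed.

Section UltrafilterLimits.
Context {T : Type} {U : set_system T} {UU : UltraFilter U}.

(** Compactness gives a cluster point; an ultrafilter contains each set or its complement, so a
    cluster point is a limit. *)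
Lemma ultra_compact_cvg {S : topologicalType} (A : set S) (f : T -> S) :
  compact A -> (\forall t \near U, A (f t)) -> exists l : S, f @ U --> l.
Proof.
move=> cA fA; have [l [Al ll]] := cA (f @ U) _ fA; exists l => B Bl.
have [//|nB] := in_ultra_setVsetC (f @^-1` B) UU.
by have [z []] := ll (~` B) B nB Bl.
Qed.

Lemma ultra_bounded_mx_cvg {R : realType} {m n : nat}
    (f : T -> 'M[R]_(m, n)) B :
  (\forall t \near U, `|f t| <= B) -> exists l : 'M[R]_(m, n), f @ U --> l.
Proof.
move=> fB.
have /choice[l lP] (ij : 'I_m * 'I_n) :
    exists l : R, (fun t => f t ij.1 ij.2) @ U --> l.
  apply: (ultra_compact_cvg (A := `[- B, B])); first exact: segment_compact.
  apply: filterS fB => t ftB; rewrite /= in_itv/= -ler_norml.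
  exact: le_trans (mx_entry_norm _ _ _) ftB.
exists (\matrix_(i, j) l (i, j)); apply: cvg_mx => i j.
by rewrite mxE; exact: (lP (i, j)).
Qed.

End UltrafilterLimits.

(** * The Euclidean inner product *)

Section EuclideanProduct.
Context {R : realType} {m : nat}.
Implicit Types u v w : 'cV[R]_m.

Definition dot u v : R := \sum_k u k 0 * v k 0.

Lemma dotE u v : u^T *m v = (dot u v)%:M.
Proof.
apply/matrixP => i j; rewrite !ord1 !mxE eqxx mulr1n.
by apply: eq_bigr => k _; rewrite mxE.
Qed.

Lemma dotC u v : dot u v = dot v u.
Proof. by apply: eq_bigr => k _; rewrite mulrC. Qed.

Lemma dot0r u : dot u 0 = 0.
Proof. by rewrite /dot big1// => k _; rewrite mxE mulr0. Qed.

Lemma dotDr u v w : dot u (v + w) = dot u v + dot u w.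
Proof.
by rewrite /dot -big_split/=; apply: eq_bigr => k _; rewrite mxE mulrDr.
Qed.

Lemma dotZr u s v : dot u (s *: v) = s * dot u v.
Proof.
by rewrite /dot mulr_sumr; apply: eq_bigr => k _; rewrite mxE mulrCA.
Qed.

Lemma dotZl u s v : dot (s *: u) v = s * dot u v.
Proof. by rewrite dotC dotZr dotC. Qed.

Lemma dotNr u v : dot u (- v) = - dot u v.
Proof. by rewrite -scaleN1r dotZr mulN1r. Qed.

Lemma dotBr u v w : dot u (v - w) = dot u v - dot u w.
Proof. by rewrite dotDr dotNr. Qed.

Lemma dot_sumr (I : Type) (r : seq I) (P : pred I) (F : I -> 'cV[R]_m) u :
  dot u (\sum_(i <- r | P i) F i) = \sum_(i <- r | P i) dot u (F i).
Proof.
by elim/big_rec2 : _ => [|i _ v _ <-]; [exact: dot0r|exact: dotDr].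
Qed.

Lemma dotvv_eq0 u : dot u u = 0 -> u = 0.
Proof.
move/eqP; rewrite psumr_eq0 => [/allP u0|k _]; last by rewrite -expr2 sqr_ge0.
apply/matrixP => k j; rewrite ord1 mxE; apply/eqP.
by have := u0 k (mem_index_enum _); rewrite mulf_eq0 orbb.
Qed.

Lemma dot_continuous u : continuous (dot u).
Proof.
apply: (@continuous_big R _ +%R) => [|k _ v]; first exact: add_continuous.
exact: (cvgM (cvg_cst (u k 0)) (@coord_continuous R m 1 k 0 v)).
Qed.

Lemma is_derive_dot u (f : R -> 'cV[R]_m) (t : R) (df : 'cV[R]_m) :
  is_derive t 1 f df -> is_derive t 1 (fun s => dot u (f s)) (dot u df).
Proof.
move=> [fdf dfE].
have fk k : is_derive t 1 (fun s => f s k 0) (df k 0).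
  apply: DeriveDef; first by have /derivable_mxP := fdf; exact.
  by rewrite -dfE derive_mx// mxE.
have := @is_derive_sum _ _ _ m (fun k => u k 0 \*: (fun s => f s k 0)) t 1
  (fun k => u k 0 *: df k 0) (fun k => is_deriveZ (u k 0) (fk k)).
by rewrite fct_sumE.
Qed.

End EuclideanProduct.

(** * Recession directions *)

Section RecessionCone.
Context {R : realType} {V : normedModType R}.
Implicit Types (C : set V) (d : V).

(** A single translation suffices to encode the recession cone of a convex set: iterating it and
    using convexity yields all nonnegative multiples of [d]. *)
Definition recession C : set V := [set d | forall z, C z -> C (z + d)].

Lemma recession_sum C (I : Type) (r : seq I) (P : pred I) (F : I -> V) :
  (forall i, P i -> recession C (F i)) -> recession C (\sum_(i <- r | P i) F i).
Proof.
move=> rF; elim/big_rec : _ => [z Cz|i d Pi rd z Cz]; first by rewrite addr0.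
by rewrite addrA; apply: rd; exact: (rF _ Pi).
Qed.

(** The convex combinations [(1 - s t) *: z + s t *: p t] lie in [C] and tend to [z + d]. *)
Lemma recession_limit C (T : Type) (U : set_system T) (p : T -> V)
    (s : T -> R) d :
  ProperFilter U -> convex_set C -> closed C ->
  (\forall t \near U, C (p t)) -> (\forall t \near U, 0 <= s t <= 1) ->
  s @ U --> (0 : R) -> (fun t => s t *: p t) @ U --> d -> recession C d.
Proof.
move=> UU /convex_setP cC clC Cp s01 s0 sp z Cz.
apply: (@closed_cvg _ _ U _ (fun t => (1 - s t) *: z + s t *: p t) C clC).
  near=> t; rewrite addrC; apply: cC => //; last by near: t.
  by near: t.
apply: cvgD sp; rewrite -[X in _ --> X]scale1r -[X in X *: _](subr0 1).
by apply: cvgZr_tmp; apply: cvgB => //; exact: cvg_cst.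
Unshelve. all: by end_near. Qed.

End RecessionCone.

(** * Summation by parts on the graph, and monotonicity from the derivative *)

Lemma sum_by_parts {R : realFieldType} {N : nat} (e : rel 'I_N)
    (a : 'I_N -> 'I_N -> R) (w y : 'I_N -> R) :
  symmetric e -> (forall i j, e i j -> a i j = a j i) ->
  \sum_i w i * \sum_(j | e i j) a i j * (y j - y i) =
  - (2^-1 * \sum_i \sum_(j | e i j) a i j * ((w j - w i) * (y j - y i))).
Proof.
move=> e_sym a_sym; set S := LHS.
have S1 : S = \sum_i \sum_(j | e i j) a i j * (w i * (y j - y i)).
  apply: eq_bigr => i _; rewrite mulr_sumr; apply: eq_bigr => j _.
  by rewrite mulrCA.
(* Exchanging the roles of [i] and [j] uses the symmetry of edges and weights; adding [S1] and [S2]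
   produces the symmetric form. *)
have S2 : S = \sum_i \sum_(j | e i j) a i j * (w j * (y i - y j)).
  rewrite S1 (exchange_big_dep xpredT)//=; apply: eq_bigr => i _.
  under eq_bigl do rewrite e_sym.
  by apply: eq_bigr => j eij; rewrite (a_sym i j).
have -> : \sum_i \sum_(j | e i j) a i j * ((w j - w i) * (y j - y i)) =
    - (S + S).
  rewrite [in X in - (_ + X)]S2 S1 -big_split/= -sumrN; apply: eq_bigr => i _.
  rewrite -big_split/= -sumrN; apply: eq_bigr => j _; ring.
by field.
Qed.

Lemma le_init_of_derive_le0 {R : realType} (f df : R -> R) :
  {within `[0, +oo[, continuous f} ->
  (forall t : R, 0 < t -> is_derive t 1 f (df t)) ->
  (forall t : R, 0 < t -> df t <= 0) ->
  forall t : R, 0 <= t -> f t <= f 0.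
Proof.
move=> cf fdf df0 t t0.
apply: (@ler0_derive1_nincry _ f 0) => // s; rewrite in_itv/= andbT => s0.
  by have [] := fdf s s0.
by rewrite derive1E; have [_ ->] := fdf s s0; exact: df0.
Qed.

(** * Normals of the hypersurface against recession directions *)

Section Consensus.
Context {R : realType} {n N : nat}.
Variables (c : 'cV[R]_n.+1 -> R) (K : set 'cV[R]_n.+1).
Hypotheses (c_C1 : C1 c) (K_convex : convex_set K)
  (K_bd : level_set c = boundary K).

Lemma diff_grad y v : 'd c y v = dot (grad c y) v.
Proof.
have cy := proj1 c_C1 y.
have {1}-> : v = \sum_k v k 0 *: delta_mx k 0.
  rewrite [LHS]matrix_sum_delta; apply: eq_bigr => k _.
  by rewrite big_ord1.
rewrite linear_sum; apply: eq_bigr => k _.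
by rewrite linearZ/= mxE deriveE// mulrC.
Qed.

(** Up to the two normalising factors, whose product is a square, these are values of ['d c y],
    which cannot take both signs on [closure K] seen from [y]. *)
Lemma normal_one_sided y z w : level_set c y -> closure K z -> closure K w ->
  0 <= dot (unit_normal c y) (z - y) * dot (unit_normal c y) (w - y).
Proof.
move=> cy Kz Kw; rewrite !dotZl -!diff_grad mulrACA mulr_ge0//.
  by rewrite -expr2 sqr_ge0.
have bdP x : c x = 0 <-> (closure K `\` K^°) x.
  by rewrite -[_ `\` _]/(boundary K) -K_bd.
have one_sided v1 v2 := @boundary_one_sided _ _ K c y v1 v2 K_convex bdP
  (proj1 c_C1 y) cy.
have [dz|dz|->] := ltgtP ('d c y (z - y)) 0; last by rewrite mul0r.
- have [dw|//|->] := ltgtP ('d c y (w - y)) 0; last by rewrite mulr0.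
    by rewrite ltW// nmulr_rgt0.
  by move=> dw; have := one_sided w z Kw Kz dw; rewrite leNgt dz.
- by rewrite mulr_ge0 ?(ltW dz)//; exact: (one_sided z).
Qed.

Lemma dot_tangent_proj y d u : dot d (tangent_proj c y *m u) =
  dot d u - dot (unit_normal c y) d * dot (unit_normal c y) u.
Proof.
rewrite mulmxBl mul1mx -mulmxA dotE mul_mx_scalar dotBr dotZr.
by rewrite (dotC d (unit_normal _ _)) mulrC.
Qed.

(** Since [y + d] is again in [closure K], [d] is itself a difference of the form allowed in
    [normal_one_sided]. *)
Lemma normal_recession y z d : level_set c y -> closure K z ->
  recession (closure K) d ->
  0 <= dot (unit_normal c y) d * dot (unit_normal c y) (z - y).
Proof.
move=> cy Kz dK; have [Ky _] : boundary K y by rewrite -K_bd.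
have := normal_one_sided cy (dK _ Ky) Kz.
by rewrite [y + d]addrC addrK.
Qed.

(** Testing [d] against the point [y - d] shows that minus the square of the product is
    nonnegative. *)
Lemma normal_lineality y d : level_set c y ->
  recession (closure K) d -> recession (closure K) (- d) ->
  dot (unit_normal c y) d = 0.
Proof.
move=> cy dK NdK; have [Ky _] : boundary K y by rewrite -K_bd.
have := normal_recession cy (NdK _ Ky) dK.
rewrite addrAC subrr add0r dotNr mulrN oppr_ge0 => le0.
by apply/eqP; rewrite -sqrf_eq0 expr2 eq_le le0 -expr2 sqr_ge0.
Qed.

(** * Monotone quantities along a solution *)

Variables (e : rel 'I_N) (a : 'I_N -> 'I_N -> R).
Hypotheses (e_sym : symmetric e) (a_sym : forall i j, e i j -> a i j = a j i)
  (a_ge0 : forall i j, e i j -> 0 <= a i j).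
Variables (x0 : 'I_N -> 'cV[R]_n.+1) (x : R -> 'I_N -> 'cV[R]_n.+1).
Hypothesis x_sol : consensus_solution c e a x0 x.

Lemma solution_closure t i : 0 <= t -> closure K (x t i).
Proof.
move=> t0; have [_ xH _ _] := x_sol.
by have := xH t i t0; rewrite K_bd => -[].
Qed.

Lemma continuous_dot_solution d i :
  {within `[0, +oo[, continuous (fun t => dot d (x t i))}.
Proof.
have [_ _ cx _] := x_sol; move=> t.
by apply: continuous_comp; [exact: cx|exact: dot_continuous].
Qed.

Lemma is_derive_dot_solution d i (t : R) : 0 < t ->
  is_derive t 1 (fun s => dot d (x s i))
    (\sum_(j | e i j) a i j * (dot d (x t j) - dot d (x t i)) -
     dot (unit_normal c (x t i)) d *
     dot (unit_normal c (x t i)) (\sum_(j | e i j) a i j *: (x t j - x t i))).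
Proof.
move=> t0; have [_ _ _ dx] := x_sol.
have := is_derive_dot d (dx t i t0).
rewrite /consensus_field dot_tangent_proj dot_sumr.
by under eq_bigr do rewrite dotZr dotBr.
Qed.

(** The linear coupling terms cancel, by [sum_by_parts] with constant weight 1; what the projection
    subtracts is nonnegative edge by edge, by [normal_recession]. *)
Lemma sum_dot_recession_le d t : recession (closure K) d -> 0 <= t ->
  \sum_i dot d (x t i) <= \sum_i dot d (x0 i).
Proof.
move=> dK t0; have [x0E xH _ _] := x_sol.
under [leRHS]eq_bigr do rewrite -x0E.
apply: (le_init_of_derive_le0 (f := fun t => \sum_i dot d (x t i))
  (df := fun t => \sum_i
    (\sum_(j | e i j) a i j * (dot d (x t j) - dot d (x t i)) -
     dot (unit_normal c (x t i)) d *
     dot (unit_normal c (x t i))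
       (\sum_(j | e i j) a i j *: (x t j - x t i))))) => //.
- apply: (@continuous_big R _ +%R) => [|i _]; first exact: add_continuous.
  exact: continuous_dot_solution.
- move=> s s0.
  have := is_derive_sum (fun i => is_derive_dot_solution d i s0).
  by rewrite fct_sumE.
- move=> s s0; rewrite sumrB subr_le0.
  have := sum_by_parts (fun=> 1) (fun i => dot d (x s i)) e_sym a_sym.
  under eq_bigr do rewrite mul1r.
  move=> ->; rewrite big1 => [|i _]; last first.
    by rewrite big1// => j _; rewrite subrr mul0r mulr0.
  rewrite mulr0 oppr0; apply: sumr_ge0 => i _.
  rewrite dot_sumr mulr_sumr; apply: sumr_ge0 => j eij.
  rewrite dotZr mulrCA mulr_ge0 ?a_ge0// normal_recession//.
    by apply: xH; exact: ltW.
  by apply: solution_closure; exact: ltW.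
Qed.

(** The projection term vanishes by [normal_lineality]; [sum_by_parts] with equal arguments turns
    the rest into minus a weighted sum of squares over the edges. *)
Lemma sum_dot_sqr_lineality_le d t :
  recession (closure K) d -> recession (closure K) (- d) -> 0 <= t ->
  \sum_i dot d (x t i) ^+ 2 <= \sum_i dot d (x0 i) ^+ 2.
Proof.
move=> dK NdK t0; have [x0E xH _ _] := x_sol.
under [leRHS]eq_bigr do rewrite -x0E.
apply: (le_init_of_derive_le0 (f := fun t => \sum_i dot d (x t i) ^+ 2)
  (df := fun t => \sum_i 2 * (dot d (x t i) *
    \sum_(j | e i j) a i j * (dot d (x t j) - dot d (x t i))))) => //.
- apply: (@continuous_big R _ +%R) => [|i _]; first exact: add_continuous.
  by move=> s; apply: cvgM; exact: continuous_dot_solution.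
- move=> s s0.
  have df i : is_derive s 1 (fun t => dot d (x t i) ^+ 2) (2 * (dot d (x s i) *
      \sum_(j | e i j) a i j * (dot d (x s j) - dot d (x s i)))).
    have := is_deriveX 2 (is_derive_dot_solution d i s0).
    rewrite normal_lineality//; last by apply: xH; exact: ltW.
    by rewrite mul0r subr0 /GRing.scale/= expr1 -mulrA.
  by have := is_derive_sum df; rewrite fct_sumE.
- move=> s s0; rewrite -mulr_sumr (sum_by_parts _ _ e_sym a_sym).
  rewrite mulrN oppr_le0 mulr_ge0// mulr_ge0//.
  apply: sumr_ge0 => i _; apply: sumr_ge0 => j eij.
  by rewrite mulr_ge0 ?a_ge0// -expr2 sqr_ge0.
Qed.

(** * Boundedness of solutions by rescaling *)

Lemma solution_bounded : exists B, forall t, 0 <= t -> \sum_i `|x t i| <= B.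
Proof.
pose M t := \sum_i `|x t i|.
apply: contrapT => unbounded.
have big B : exists2 t, 0 <= t & B < M t.
  apply: contrapT => NB; apply: unbounded; exists B => t t0.
  by rewrite leNgt; apply/negP => BM; apply: NB; exists t.
(* Unboundedness makes this filter proper; an ultrafilter finer than it makes all rescaled states
   converge without extracting subsequences. *)
pose F := filter_from [set: R] (fun B => [set t | 0 <= t /\ B < M t]).
have FF : Filter F.
  apply: filter_from_filter; first by exists 0.
  move=> B B' _ _; exists (Num.max B B') => // t [t0].
  by rewrite gt_max => /andP[].
have {}FF : ProperFilter F.
  by apply: filter_from_proper => B _; have [t t0 Bt] := big B; exists t.
have [U [UU FU]] := ultraFilterLemma FF.
have U0 : \forall t \near U, 0 <= t by apply: FU; exists 0 => // t [].
have UM B : \forall t \near U, B < M t by apply: FU; exists B => // t [].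
have Minv : (fun t => (M t)^-1) @ U --> (0 : R).
  apply/cvgrPdist_le => eps eps0; near=> t.
  have Mt : eps^-1 < M t by near: t; exact: UM.
  have Mt0 : 0 < M t by rewrite (lt_trans _ Mt)// invr_gt0.
  by rewrite sub0r normrN gtr0_norm ?invr_gt0// invf_ple// ltW.
have /choice[r rP] (i : 'I_N) :
    exists l : 'cV[R]_n.+1, (fun t => (M t)^-1 *: x t i) @ U --> l.
  apply: (ultra_bounded_mx_cvg (B := 1)).
  near=> t.
  have Mt0 : 0 < M t by near: t; exact: UM.
  rewrite normrZ gtr0_norm ?invr_gt0// ler_pdivrMl// mulr1.
  by rewrite /M (bigD1 i)//= lerDl sumr_ge0.
have r1 : \sum_i `|r i| = 1.
  have : (fun t => \sum_i `|(M t)^-1 *: x t i|) @ U --> \sum_i `|r i|.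
    apply: (@cvg_big R _ +%R) => [|i _]; first exact: add_continuous.
    by apply: cvg_norm; exact: rP.
  have : (fun t => \sum_i `|(M t)^-1 *: x t i|) @ U --> (1 : R).
    apply: cvg_near_cst; near=> t.
    have Mt0 : 0 < M t by near: t; exact: UM.
    under eq_bigr do rewrite normrZ gtr0_norm ?invr_gt0//.
    by rewrite -mulr_sumr mulVf// gt_eqF.
  by move=> h1 h2; exact: (cvg_unique _ h2 h1).
have rK i : recession (closure K) (r i).
  apply: (recession_limit (U := U) (p := fun t => x t i)
    (s := fun t => (M t)^-1)) => //.
  - exact: convex_closure.
  - exact: closed_closure.
  - by apply: filterS U0 => t; exact: solution_closure.
  - near=> t.
    have Mt : 1 < M t by near: t; exact: UM.
    by rewrite invr_ge0 invf_le1 ?(lt_trans ltr01)// !ltW// (lt_trans ltr01).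
have dotr d i : (fun t => (M t)^-1 * dot d (x t i)) @ U --> dot d (r i).
  under eq_fun do rewrite -dotZr.
  by apply: continuous_cvg; [exact: dot_continuous|exact: rP].
have sumr0 : \sum_i r i = 0.
  set d := \sum_i r i; apply: dotvv_eq0; apply/eqP; rewrite eq_le.
  apply/andP; split; last by rewrite sumr_ge0// => k _; rewrite -expr2 sqr_ge0.
  have dK : recession (closure K) d by exact: recession_sum.
  have lim_dot : (fun t => \sum_i (M t)^-1 * dot d (x t i)) @ U --> dot d d.
    rewrite {2}/d dot_sumr.
    apply: (@cvg_big R _ +%R) => [|i _]; [exact: add_continuous|exact: dotr].
  (* The zero on the right is the limit of the fixed initial value divided by [M t]. *)
  rewrite -(mul0r (\sum_i dot d (x0 i))).
  apply: (ler_cvg_to lim_dot (g := fun t => (M t)^-1 * \sum_i dot d (x0 i))).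
  - by apply: cvgM => //; exact: cvg_cst.
  - near=> t; rewrite -mulr_sumr ler_wpM2l ?invr_ge0 ?sumr_ge0//.
    by apply: sum_dot_recession_le => //; near: t.
have NrK i : recession (closure K) (- r i).
  have -> : - r i = \sum_(j | j != i) r j.
    apply/esym/eqP; rewrite -addr_eq0 addrC.
    by apply/eqP; rewrite -[RHS]sumr0 [RHS](bigD1 i).
  exact: recession_sum.
suff r0 i : r i = 0.
  by move: r1; rewrite big1 => [/esym/eqP|i _]; rewrite ?oner_eq0// r0 normr0.
apply: dotvv_eq0; apply/eqP; rewrite -sqrf_eq0 eq_le sqr_ge0 andbT.
(* The squared coordinate of agent [i] alone is at most the constant [C]; dividing by the square of
   [M t] forces its limit, the square of [dot (r i) (r i)], to be at most 0. *)
set C := \sum_j dot (r i) (x0 j) ^+ 2.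
have : (fun t => ((M t)^-1 * dot (r i) (x t i)) ^+ 2) @ U -->
    dot (r i) (r i) ^+ 2.
  exact: (cvgM (dotr _ _) (dotr _ _)).
have : (fun t => (M t)^-1 ^+ 2 * C) @ U --> 0 ^+ 2 * C.
  exact: (cvgM (cvgM Minv Minv) (cvg_cst _)).
rewrite expr0n mul0r => h1 h2; apply: (ler_cvg_to h2 h1); near=> t.
rewrite exprMn ler_wpM2l ?sqr_ge0//.
apply: (le_trans _ (sum_dot_sqr_lineality_le (d := r i) (t := t) _ _ _)) => //;
  last by near: t.
by rewrite (bigD1 i)//= lerDl sumr_ge0// => j _; exact: sqr_ge0.
Unshelve. all: by end_near. Qed.

End Consensus.

(** * From the sup norm bound to the Euclidean limit superior *)

Lemma enorm_le {R : realType} {n : nat} (v : 'cV[R]_n.+1) :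
  enorm v <= Num.sqrt n.+1%:R * `|v|.
Proof.
have vs k : v k 0 ^+ 2 <= `|v| ^+ 2.
  by rewrite -real_normK ?num_real// lerXn2r ?nnegrE// mx_entry_norm.
have v0 := normr_ge0 v; move: `|v| v0 vs => s s0 vs.
rewrite -(ger0_norm s0) -sqrtr_sqr -sqrtrM// ler_wsqrtr//.
rewrite mulr_natl -[in leRHS](card_ord n.+1) -sumr_const.
by apply: ler_sum => k _; exact: vs.
Qed.

(** The half-line of nonnegative [t] contains a neighbourhood of infinity, so the supremum over it
    dominates the limit superior. *)
Lemma limf_esup_lt_pinfty {R : realType} (f : R -> R) B :
  (forall t, 0 <= t -> f t <= B) ->
  (limf_esup (fun t => (f t)%:E) (pinfty_nbhs R) < +oo)%E.
Proof.
move=> fB; rewrite limf_esupE; apply: (@le_lt_trans _ _ B%:E); last exact: ltry.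
apply: (@le_trans _ _ (ereal_sup ((fun t => (f t)%:E) @` `[0, +oo[))).
  apply: ereal_inf_lbound; exists `[0, +oo[%classic => //.
  exists 0; split; first exact: num_real.
  by move=> t /ltW t0; rewrite /= in_itv/= t0.
apply: ge_ereal_sup => _ [t + <-]; rewrite /= in_itv/= andbT => t0.
by rewrite lee_fin fB.
Qed.

(** Finiteness at infinity is expressed by the limit superior, that is, as eventual boundedness of
    the Euclidean norm; it follows from a bound uniform in [t >= 0]. *)
Theorem theorem6 (R : realType) (n N : nat)
    (c : 'cV[R]_n.+1 -> R) (c_C1 : C1 c) (c_reg : regular c)
    (K : set 'cV[R]_n.+1) (K_convex : convex_set K)
    (K_bd : level_set c = boundary K)
    (e : rel 'I_N) (e_sym : symmetric e) (e_irr : irreflexive e)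
    (a : 'I_N -> 'I_N -> R)
    (a_sym : forall i j, e i j -> a i j = a j i)
    (a_ge0 : forall i j, e i j -> 0 <= a i j)
    (x0 : 'I_N -> 'cV[R]_n.+1) (x0_H : forall i, level_set c (x0 i))
    (x : R -> 'I_N -> 'cV[R]_n.+1)
    (x_sol : consensus_solution c e a x0 x) (i : 'I_N) :
  (limf_esup (fun t : R => (enorm (x t i))%:E) (pinfty_nbhs R) < +oo)%E.
Proof.
have [B xB] := solution_bounded c_C1 K_convex K_bd e_sym a_sym a_ge0 x_sol.
apply: (@limf_esup_lt_pinfty _ _ (Num.sqrt n.+1%:R * B)) => t t0.
rewrite (le_trans (enorm_le _))// ler_wpM2l ?sqrtr_ge0//.
by rewrite (le_trans _ (xB t t0))// (bigD1 i)//= lerDl sumr_ge0.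
Qed.
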